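(* Let $\rho_{AB}$ be a two-qubit Bell diagonal state, i.e. $\rho_{AB}=p_0|\phi^+\rangle\langle\phi^+|+p_1|\psi^+\rangle\langle\psi^+|+p_2|\psi^-\rangle\langle\psi^-|+p_3|\phi^-\rangle\langle\phi^-|$ with $(p_0,p_1,p_2,p_3)$ a probability vector, where $|\phi^\pm\rangle=(|00\rangle\pm|11\rangle)/\sqrt2$ and $|\psi^\pm\rangle=(|01\rangle\pm|10\rangle)/\sqrt2$. Let $R_{\mu\nu}=\operatorname{Tr}[(\sigma_\mu\otimes\sigma_\nu)\rho_{AB}]$ for $\mu,\nu\in\{0,1,2,3\}$, and let $\lambda_1\le\lambda_2\le\lambda_3$ be the numbers $|R_{11}|,|R_{22}|,|R_{33}|$ arranged in nondecreasing order. Then the one-sided negativity of quantumness of $\rho_{AB}$ on $A$ is $$Q^A_{\mathcal N}(\rho_{AB})=\frac{\lambda_2}{2}.$$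
   Context: $\sigma_0=\mathbb I$, $\sigma_1=\sigma_x$, $\sigma_2=\sigma_y$, $\sigma_3=\sigma_z$ are the identity and Pauli matrices. For a bipartite state $\tau_{X:Y}$, the negativity is $\mathcal N_{X:Y}(\tau)=(\|\tau^{\Gamma}\|_1-1)/2$, where $\tau^\Gamma$ is the partial transpose with respect to one of the parties (in any product basis) and $\|\cdot\|_1$ is the trace norm (sum of singular values). For a finite-dimensional system $A$ of dimension $m$ and an orthonormal basis $\{|a_k\rangle\}_{k=1}^m$ of $A$, the measurement interaction is the isometry $V:A\to A\otimes A'$, with $A'$ an $m$-dimensional system with computational basis $\{|k\rangle\}$, defined by $V|a_k\rangle=|a_k\rangle|k\rangle$. The one-sided negativity of quantumness of a state $\rho_{AB}$ on $A$ is $Q^A_{\mathcal N}(\rho_{AB})=\min\mathcal N_{AB:A'}\big((V\otimes\mathbb I_B)\rho_{AB}(V\otimes\mathbb I_B)^\dagger\big)$, the minimum being over all orthonormal bases of $A$ defining $V$. *)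

(* Defs.v *)
From HB Require Import structures.
From mathcomp Require Import all_boot all_order all_algebra.
From mathcomp Require Import complex mxtens.
Set Implicit Arguments. Unset Strict Implicit. Unset Printing Implicit Defensive.
Import Order.TTheory GRing.Theory Num.Theory.
Local Open Scope ring_scope.
Local Open Scope complex_scope.

Section QDefs.
Variable R : rcfType.
Local Notation C := R[i].

Definition adj m n (A : 'M[C]_(m, n)) : 'M[C]_(n, m) := (map_mx Num.conj A)^T.

Definition sigma (mu : 'I_4) : 'M[C]_2 :=
  \matrix_(i < 2, j < 2)
    match nat_of_ord mu, nat_of_ord i, nat_of_ord j with
    | 0, 0, 0 => 1 | 0, 1, 1 => 1
    | 1, 0, 1 => 1 | 1, 1, 0 => 1
    | 2, 0, 1 => - 'i | 2, 1, 0 => 'i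
    | 3, 0, 0 => 1 | 3, 1, 1 => -1
    | _, _, _ => 0
    end.

Definition ket (k : 'I_2) : 'cV[C]_2 := delta_mx k 0.
Definition k0 : 'I_2 := ord0.
Definition k1 : 'I_2 := ord_max.

Definition isqrt2 : C := (Num.sqrt (2 : R))^-1%:C.

Definition phi_p : 'cV[C]_(2 * 2) := isqrt2 *: (ket k0 *t ket k0 + ket k1 *t ket k1).
Definition phi_m : 'cV[C]_(2 * 2) := isqrt2 *: (ket k0 *t ket k0 - ket k1 *t ket k1).
Definition psi_p : 'cV[C]_(2 * 2) := isqrt2 *: (ket k0 *t ket k1 + ket k1 *t ket k0).
Definition psi_m : 'cV[C]_(2 * 2) := isqrt2 *: (ket k0 *t ket k1 - ket k1 *t ket k0).

Definition proj n (v : 'cV[C]_n) : 'M[C]_n := v *m adj v.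

Definition bell_diag (p : 'I_4 -> R) : 'M[C]_(2 * 2) :=
  (p 0)%:C *: proj phi_p + (p 1)%:C *: proj psi_p
  + (p 2)%:C *: proj psi_m + (p 3)%:C *: proj phi_m.

Definition corr (rho : 'M[C]_(2 * 2)) (mu nu : 'I_4) : C :=
  \tr ((sigma mu *t sigma nu) *m rho).

Definition lambdas (rho : 'M[C]_(2 * 2)) : seq C :=
  sort <=%R [:: `|corr rho 1 1|; `|corr rho 2 2|; `|corr rho 3 3|].
Definition lambda2 (rho : 'M[C]_(2 * 2)) : C := nth 0 (lambdas rho) 1.

(* eigenvalues (with multiplicity) of a square matrix over the closed field C:
   the roots of its characteristic polynomial *)
Definition eigenvalues n (A : 'M[C]_n) : seq C :=
  projT1 (closed_field_poly_normal (char_poly A)).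

Definition singular_values n (A : 'M[C]_n) : seq C :=
  map sqrtC (eigenvalues (adj A *m A)).

Definition trace_norm n (A : 'M[C]_n) : C := \sum_(s <- singular_values A) s.

Definition ptrans2 m k (A : 'M[C]_(m * k)) : 'M[C]_(m * k) :=
  \matrix_(x, y)
    A (mxtens_index ((mxtens_unindex x).1, (mxtens_unindex y).2))
      (mxtens_index ((mxtens_unindex y).1, (mxtens_unindex x).2)).

Definition negativity m k (tau : 'M[C]_(m * k)) : C :=
  (trace_norm (ptrans2 tau) - 1) / 2.

(* orthonormal basis {a_k} of A = C^2, given as the columns of U *)
Definition orthonormal_basis (U : 'M[C]_2) : Prop := adj U *m U = 1%:M.

(* (V (x) I_B), V|a_k> = |a_k>|k>, with output ordered as (A (x) B) (x) A' *)
Definition meas_iso (U : 'M[C]_2) : 'M[C]_((2 * 2) * 2, 2 * 2) :=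
  \sum_(k < 2) ((col k U *t (1%:M : 'M[C]_2)) *t ket k) *m (adj (col k U) *t (1%:M : 'M[C]_2)).

Definition post_meas_state (U : 'M[C]_2) (rho : 'M[C]_(2 * 2))
  : 'M[C]_((2 * 2) * 2) := meas_iso U *m rho *m adj (meas_iso U).

Definition is_QNA (rho : 'M[C]_(2 * 2)) (x : C) : Prop :=
  (forall U, orthonormal_basis U -> x <= negativity (post_meas_state U rho))
  /\ (exists U, orthonormal_basis U /\ negativity (post_meas_state U rho) = x).

End QDefs.

(* Main.v *)
Require Import Defs.
From HB Require Import structures.
From mathcomp Require Import all_boot all_order all_algebra.
From mathcomp Require Import complex mxtens spectral ring lra.
Import Order.TTheory GRing.Theory Num.Theory.
Local Open Scope ring_scope.

(** Write rho_kl = <a_k| rho |a_l>, an operator on B. The partial transpose of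
    the post-measurement state is the sum of |a_k><a_l| (x) rho_kl (x) |l><k|, so
    its trace norm is the sum of those of the four blocks rho_kl. The diagonal
    blocks are positive and contribute 1 in total, and the off-diagonal ones are
    adjoint to each other: the negativity is the trace norm of rho_01.

    For a Bell diagonal state with correlations c_i, rho_01 is the sum of
    c_i v_i sigma_i / 4 with v_i = <a_0| sigma_i |a_1>, and the square of its trace
    norm is (sum c_i^2 |v_i|^2 + |sum c_i^2 v_i^2|) / 8. Orthonormality gives
    sum v_i^2 = 0 and sum |v_i|^2 = 2. Ordering c_1^2 <= c_2^2 <= c_3^2 and putting
    A = (c_3^2 - c_2^2) |v_3|^2 and B = (c_2^2 - c_1^2) |v_1|^2, the first sum is
    2 c_2^2 + A - B while the second is at least B - A in modulus, whence the
    bound c_2^2 / 4; it is attained when v_3 = 0, i.e. on the eigenbasis of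
    sigma_3. *)

(** * Trace norms from spectral decompositions of Gram matrices *)

Section TraceNorm.
Local Set Implicit Arguments. Local Unset Strict Implicit.
Variable R : rcfType.
Local Notation C := R[i].

Lemma adjE m n (A : 'M[C]_(m, n)) i j : adj A i j = (A j i)^*.
Proof. by rewrite !mxE. Qed.

Lemma adjK m n : cancel (@adj R m n) (@adj R n m).
Proof. by move=> A; apply/matrixP => i j; rewrite !adjE conjCK. Qed.

Lemma adj_mul m n q (A : 'M[C]_(m, n)) (B : 'M[C]_(n, q)) :
  adj (A *m B) = adj B *m adj A.
Proof. by rewrite /adj map_mxM trmx_mul. Qed.

Lemma char_poly_conj n (P Q D : 'M[C]_n) :
  Q *m P = 1%:M -> char_poly (P *m D *m Q) = char_poly D.
Proof.
move=> QP; have PQ : P *m Q = 1%:M by apply: mulmx1C.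
pose P' := map_mx polyC P; pose Q' := map_mx polyC Q.
have PQ' : P' *m Q' = 1%:M by rewrite -map_mxM PQ map_mx1.
rewrite /char_poly.
have -> : char_poly_mx (P *m D *m Q) = P' *m char_poly_mx D *m Q'.
  rewrite /char_poly_mx mulmxBr mulmxBl !map_mxM; congr (_ - _).
  by rewrite mul_mx_scalar -scalemxAl PQ' scalemx1.
rewrite !det_mulmx mulrC mulrA -det_mulmx -[Q' *m P']map_mxM QP map_mx1 det1.
by rewrite mul1r.
Qed.

(** [eigenvalues] is an unspecified factorisation of the characteristic polynomial, so its list is
    known only up to permutation. That is enough for a sum: any unitary diagonalisation of the Gram
    matrix computes the trace norm. *)
Lemma trace_norm_diag n (A P : 'M[C]_n) (d : 'rV[C]_n) :
    adj P *m P = 1%:M -> adj A *m A = P *m diag_mx d *m adj P ->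
  trace_norm A = \sum_i sqrtC (d 0 i).
Proof.
move=> PP AE; rewrite /trace_norm /singular_values /eigenvalues.
case: closed_field_poly_normal => s /= sE.
have: perm_eq s [seq d 0 i | i <- enum 'I_n].
  apply: prod_XsubC_eq; move: sE.
  rewrite (monicP (char_poly_monic _)) scale1r => <-.
  rewrite AE char_poly_conj // char_poly_trig ?diag_mx_is_trig //.
  rewrite big_map big_enum /=.
  by apply: eq_bigr => i _; rewrite mxE eqxx.
move=> /(perm_map sqrtC) sP; rewrite (perm_big _ sP) /=.
by rewrite -map_comp big_map big_enum.
Qed.

Lemma gram_spectral n (A : 'M[C]_n) :
  exists P (d : 'rV[C]_n), [/\ adj P *m P = 1%:M,
    adj A *m A = P *m diag_mx d *m adj P & forall i, 0 <= d 0 i].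
Proof.
set N := adj A *m A.
have NN : N \is normalmx.
  by apply/normalmxP; rewrite -!map_trmx -/(adj N) /N adj_mul adjK.
have /orthomx_spectralP NE := NN.
have /unitarymxP := spectral_unitarymx N.
rewrite invmx_unitary ?spectral_unitarymx // in NE.
move: NE; set S := spectralmx N; set d := spectral_diag N.
rewrite -!map_trmx -/(adj S) => NE SS.
exists (adj S), d; rewrite adjK; split=> // i.
(* Hence [d 0 i] is the squared norm of column [i] of [A *m adj S]. *)
have dE : adj (A *m adj S) *m (A *m adj S) = diag_mx d.
  rewrite adj_mul adjK mulmxA -[S *m adj A *m A]mulmxA -/N NE.
  by rewrite !mulmxA SS mul1mx -mulmxA SS mulmx1.
have -> : d 0 i = diag_mx d i i by rewrite mxE eqxx.
rewrite -dE mxE sumr_ge0 // => j _.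
by rewrite adjE mulrC mul_conjC_ge0.
Qed.

Lemma det_adj n (A : 'M[C]_n) : \det (adj A) = (\det A)^*.
Proof. by rewrite /adj det_tr det_map_mx. Qed.

(** For singular values s and t, (s + t)^2 = (s^2 + t^2) + 2 s t, where the bracket is the trace of
    the Gram matrix and s t is the modulus of the determinant. *)
Lemma trace_norm_2x2 (M : 'M[C]_2) :
  trace_norm M = sqrtC (\tr (adj M *m M) + 2 * `|\det M|).
Proof.
have [P [d [PP ME d0]]] := gram_spectral M.
rewrite (trace_norm_diag PP ME) big_ord_recl big_ord1.
have trE : \tr (adj M *m M) = d 0 0 + d 0 1.
  rewrite ME mxtrace_mulC mulmxA PP mul1mx mxtrace_diag big_ord_recl big_ord1.
  by congr (_ + d 0 _); apply: val_inj.
have detE : `|\det M| = sqrtC (d 0 0) * sqrtC (d 0 1).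
  apply: (@pexpIrn _ 2) => //; rewrite ?nnegrE ?mulr_ge0 ?sqrtC_ge0 //.
  rewrite normCK mulrC -det_adj -det_mulmx ME !det_mulmx mulrAC -det_mulmx.
  rewrite (mulmx1C PP) det1 mul1r det_diag big_ord_recl big_ord1 exprMn !sqrtCK.
  by congr (_ * d 0 _); apply: val_inj.
have -> : lift ord0 ord0 = 1 :> 'I_2 by apply: val_inj.
rewrite -[LHS]sqrCK ?addr_ge0 ?sqrtC_ge0 // trE detE sqrrD !sqrtCK.
by congr sqrtC; rewrite -mulr_natl; ring.
Qed.

End TraceNorm.

(** * Block structure of the partially transposed post-measurement state *)

Section Measurement.
Local Set Implicit Arguments. Local Unset Strict Implicit.
Variable R : rcfType.
Local Notation C := R[i].

Lemma sum_mxtens_index (V : nmodType) m n (F : 'I_(m * n) -> V) :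
  \sum_x F x = \sum_i \sum_j F (mxtens_index (i, j)).
Proof.
rewrite pair_big (reindex (@mxtens_index m n)) /=; last first.
  by exists (@mxtens_unindex m n) => ? _; rewrite (mxtens_indexK, mxtens_unindexK).
by apply: eq_bigr => -[i j].
Qed.

Lemma mxtens_index_eq m n (i j : 'I_m) (k l : 'I_n) :
  (mxtens_index (i, k) == mxtens_index (j, l)) = (i == j) && (k == l).
Proof. by rewrite (can_eq (@mxtens_indexK m n)) -pair_eqE. Qed.

Lemma ptrans2E m n (A : 'M[C]_(m * n)) i j k l :
  ptrans2 A (mxtens_index (i, k)) (mxtens_index (j, l)) =
  A (mxtens_index (i, l)) (mxtens_index (j, k)).
Proof. by rewrite mxE !mxtens_indexK. Qed.

(* <a_k| rho |a_l> as an operator on B *)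
Definition meas_block (U : 'M[C]_2) (rho : 'M[C]_(2 * 2)) (k l : 'I_2) : 'M[C]_2 :=
  \matrix_(b, c) \sum_i \sum_j
    (U i k)^* * rho (mxtens_index (i, b)) (mxtens_index (j, c)) * U j l.

Lemma meas_isoE U (i b k j c : 'I_2) :
  meas_iso U (mxtens_index (mxtens_index (i, b), k)) (mxtens_index (j, c)) =
  U i k * (U j k)^* * (b == c)%:R :> C.
Proof.
rewrite /meas_iso summxE (bigD1 k) //= [X in _ + X]big1 ?addr0.
  rewrite mxE [LHS](@sum_mxtens_index _ 1 2) big_ord1 (bigD1 c) //=.
  (* [tensmxE] expects an index of the triple tensor product, whose columns are numbered by
     ['I_(1 * 2 * 1)]. *)
  have E (d : 'I_2) : mxtens_index (0 : 'I_1, d) =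
    mxtens_index (mxtens_index (0 : 'I_1, d), 0 : 'I_1) :> 'I_(1 * 2 * 1).
    by apply: val_inj; rewrite /= muln1 addn0.
  rewrite big1 => [|d dc].
    by rewrite {1}E !tensmxE addr0 !mxE !mxtens_indexK !eqxx !mulr1 mulrAC.
  by rewrite {1}E !tensmxE !mxE !mxtens_indexK (negPf dc) !mulr0.
move=> l lk; rewrite mxE big1 // => x _.
case: (mxtens_indexP (x : 'I_(1 * 2 * 1))) => y z.
by rewrite tensmxE !mxE [k == _]eq_sym (negPf lk) mulr0 mul0r.
Qed.

Lemma post_meas_stateE U rho (i b k j c l : 'I_2) :
  post_meas_state U rho (mxtens_index (mxtens_index (i, b), k))
                        (mxtens_index (mxtens_index (j, c), l)) =
  U i k * meas_block U rho k l b c * (U j l)^*.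
Proof.
have left_iso j' c' : (meas_iso U *m rho) (mxtens_index (mxtens_index (i, b), k))
    (mxtens_index (j', c')) =
  U i k * \sum_i' (U i' k)^* * rho (mxtens_index (i', b)) (mxtens_index (j', c')).
  rewrite mxE sum_mxtens_index mulr_sumr; apply: eq_bigr => i' _.
  rewrite (bigD1 b) //= big1 => [|d db]; rewrite meas_isoE.
    by rewrite eqxx mulr1 addr0 mulrA.
  by rewrite eq_sym (negPf db) mulr0 mul0r.
rewrite /post_meas_state mxE sum_mxtens_index mxE.
rewrite [X in _ * X * _]exchange_big mulr_sumr mulr_suml /=.
apply: eq_bigr => j' _.
rewrite (bigD1 c) //= big1 => [|d dc]; rewrite left_iso adjE meas_isoE.
  rewrite eqxx mulr1 addr0 rmorphM /= conjCK -mulr_suml; ring.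
by rewrite eq_sym (negPf dc) mulr0 conjC0 mulr0.
Qed.

(** By orthonormality, the Gram matrix of the sum of |a_k><a_l| (x) rho_kl (x) |l><k| is the sum of
    |a_l><a_l| (x) rho_kl^* rho_kl (x) |k><k|. It is block diagonal, and diagonalising the Gram
    matrix of each rho_kl diagonalises the whole. *)
Lemma trace_norm_ptrans_post_meas U rho :
    orthonormal_basis U ->
  trace_norm (ptrans2 (post_meas_state U rho)) =
  \sum_k \sum_l trace_norm (meas_block U rho k l).
Proof.
move=> Uu.
have UU k l : \sum_i (U i k)^* * U i l = (k == l)%:R.
  have := congr1 (fun M : 'M_2 => M k l) Uu; rewrite !mxE => <-.
  by apply: eq_bigr => i _; rewrite adjE.
have /fin_all_exists[P /fin_all_exists[d spec]] kn :=
  gram_spectral (meas_block U rho kn.1 kn.2).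
pose ix (x : 'I_(2 * 2 * 2)) :=
  (mxtens_unindex (mxtens_unindex x).1, (mxtens_unindex x).2).
have ixK i b k : ix (mxtens_index (mxtens_index (i, b), k)) = (i, b, k).
  by rewrite /ix !mxtens_indexK.
(* Column (j, c, l) of [W] is a_j (x) e (x) |l>, with e the eigenvector number c of the Gram matrix
   of block (l, j); [D] lists the eigenvalues in the same order. *)
pose W : 'M[C]_(2 * 2 * 2) := \matrix_(x, y)
  let: (i, b, k) := ix x in let: (j, c, l) := ix y in
  U i j * P (k, j) b c * (k == l)%:R.
pose D : 'rV[C]_(2 * 2 * 2) := \row_x let: (i, b, k) := ix x in d (k, i) 0 b.
have WW : adj W *m W = 1%:M.
  apply/matrixP => x y; case: (mxtens_indexP x) => ib k; case: (mxtens_indexP ib) => i b.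
  case: (mxtens_indexP y) => jc l; case: (mxtens_indexP jc) => j c.
  rewrite !mxE !mxtens_index_eq.
  rewrite !sum_mxtens_index.
  transitivity ((k == l)%:R * ((\sum_m (U m i)^* * U m j) *
    (\sum_e (P (k, i) e b)^* * P (l, j) e c))).
    rewrite [in RHS]mulr_suml mulr_sumr; apply: eq_bigr => m _.
    rewrite [in RHS]mulr_sumr mulr_sumr; apply: eq_bigr => e _.
    rewrite (bigD1 l) //= big1 => [|n nl]; rewrite adjE !mxE !ixK.
      rewrite eqxx eq_sym addr0 mulr1 !rmorphM /= conjC_nat.
      by case: eqP => [->|_]; rewrite ?mulr0 ?mul0r //=; ring.
    by rewrite (negPf nl) !mulr0.
  rewrite UU; case: eqP => [<-|_]; last by rewrite mul0r andbF.
  case: eqP => [<-|_]; last by rewrite mul0r mulr0.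
  rewrite andbT /= !mul1r; have [+ _ _] := spec (k, i).
  move=> /(congr1 (fun M : 'M_2 => M b c)); rewrite !mxE => <-.
  by apply: eq_bigr => e _; rewrite adjE.
rewrite (@trace_norm_diag _ _ _ W D WW).
  rewrite !sum_mxtens_index; under eq_bigr do rewrite exchange_big.
  rewrite exchange_big; apply: eq_bigr => k _; apply: eq_bigr => l _.
  have [PP PE _] := spec (k, l); rewrite (trace_norm_diag PP PE).
  by apply: eq_bigr => b _; rewrite mxE ixK.
apply/matrixP => x y; case: (mxtens_indexP x) => ib k; case: (mxtens_indexP ib) => i b.
case: (mxtens_indexP y) => jc l; case: (mxtens_indexP jc) => j c.
(* Both sides are compared with the entries of this block diagonal form. *)
transitivity ((k == l)%:R * \sum_n U i n * (U j n)^* *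
    (adj (meas_block U rho k n) *m meas_block U rho l n) b c).
  rewrite mxE !sum_mxtens_index -UU mulr_suml; apply: eq_bigr => m _.
  rewrite exchange_big mulr_sumr; apply: eq_bigr => n _.
  rewrite mxE !mulr_sumr; apply: eq_bigr => e _.
  rewrite !adjE !ptrans2E !post_meas_stateE !rmorphM /= conjCK.
  ring.
rewrite mxE !sum_mxtens_index mulr_sumr; apply: eq_bigr => n _.
case: (eqVneq k l) => [<-|kl]; last first.
  rewrite mul0r big1 // => e _; rewrite big1 // => m _.
  rewrite mul_mx_diag adjE !mxE !ixK !rmorphM /= conjC_nat.
  case: (eqVneq k m) => [<-|_]; last by rewrite !(mulr0, mul0r).
  by rewrite eq_sym (negPf kl) !mulr0.
have [_ -> _] := spec (k, n).
rewrite [in LHS]mxE mul1r mulr_sumr; apply: eq_bigr => e _.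
rewrite (bigD1 k) //= big1 => [|m mk]; last first.
  by rewrite mul_mx_diag !mxE !ixK eq_sym (negPf mk) !(mulr0, mul0r).
rewrite addr0 !mul_mx_diag !adjE !mxE !ixK eqxx !mulr1 !rmorphM /=; ring.
Qed.

End Measurement.

(** * Pauli expansions of qubit operators and of Bell diagonal states *)

Section Pauli.
Local Set Implicit Arguments. Local Unset Strict Implicit.
Variable R : rcfType.
Local Notation C := R[i].

Lemma sum_ord2 (V : nmodType) (F : 'I_2 -> V) : \sum_i F i = F 0 + F 1.
Proof.
by rewrite !big_ord_recl big_ord0 addr0; congr (_ + F _); apply: val_inj.
Qed.

Lemma sum_ord4 (V : nmodType) (F : 'I_4 -> V) :
  \sum_i F i = F 0 + F 1 + F 2 + F 3.
Proof.
rewrite !big_ord_recl big_ord0 addr0 !addrA.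
by congr (_ + F _ + F _ + F _); apply: val_inj.
Qed.

Lemma det_2x2 (M : 'M[C]_2) : \det M = M 0 0 * M 1 1 - M 0 1 * M 1 0.
Proof.
rewrite (expand_det_row _ 0) sum_ord2 /cofactor !det_mx11 !mxE /=.
rewrite !expr0 !expr1 !mul1r mulN1r mulrN.
by congr (_ * M _ _ - _ * M _ _); apply: val_inj.
Qed.

Lemma mulCii : 'i * 'i = -1 :> C.
Proof. by rewrite -expr2 sqrCi. Qed.

Lemma trace_norm_pauli (w : 'I_4 -> C) :
  trace_norm (\sum_mu w mu *: sigma R mu) =
  sqrtC (2 * (`|w 0| ^+ 2 + `|w 1| ^+ 2 + `|w 2| ^+ 2 + `|w 3| ^+ 2)
       + 2 * `|w 0 ^+ 2 - (w 1 ^+ 2 + w 2 ^+ 2 + w 3 ^+ 2)|).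
Proof.
rewrite trace_norm_2x2; set M := \sum_mu _.
have M00 : M 0 0 = w 0 + w 3 by rewrite summxE sum_ord4 !mxE /= ?complexiE; ring.
have M01 : M 0 1 = w 1 - 'i * w 2 by rewrite summxE sum_ord4 !mxE /= ?complexiE; ring.
have M10 : M 1 0 = w 1 + 'i * w 2 by rewrite summxE sum_ord4 !mxE /= ?complexiE; ring.
have M11 : M 1 1 = w 0 - w 3 by rewrite summxE sum_ord4 !mxE /= ?complexiE; ring.
have detE : \det M = w 0 ^+ 2 - (w 1 ^+ 2 + w 2 ^+ 2 + w 3 ^+ 2).
  have := mulCii; rewrite det_2x2 M00 M01 M10 M11 => hi; ring: hi.
have trE : \tr (adj M *m M) =
    2 * (`|w 0| ^+ 2 + `|w 1| ^+ 2 + `|w 2| ^+ 2 + `|w 3| ^+ 2).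
  rewrite /mxtrace sum_ord2 !mxE !sum_ord2 !adjE M00 M01 M10 M11 !normCK.
  rewrite !rmorphD !rmorphN !rmorphM /= conjCi; have hi := mulCii; ring: hi.
by rewrite detE trE.
Qed.

(** The diagonal correlations R_mumu: each Bell state is an eigenvector of sigma_mu (x) sigma_mu,
    and the signs are its eigenvalues. *)
Definition bell_corr (p : 'I_4 -> R) (mu : 'I_4) : R :=
  match nat_of_ord mu with
  | 0 => p 0 + p 1 + p 2 + p 3
  | 1 => p 0 + p 1 - p 2 - p 3
  | 2 => p 1 + p 3 - p 0 - p 2
  | _ => p 0 + p 3 - p 1 - p 2
  end.

Lemma isqrt2_sqr : isqrt2 R * isqrt2 R = 2^-1.
Proof.
rewrite /isqrt2 -rmorphM -invfM -expr2 sqr_sqrtr ?ler0n //.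
by rewrite fmorphV rmorph_nat.
Qed.

Lemma isqrt2_conj : (isqrt2 R)^* = isqrt2 R.
Proof. exact: conjc_real. Qed.

Lemma projE n (v : 'cV[C]_n) x y : proj v x y = v x 0 * (v y 0)^*.
Proof. by rewrite mxE big_ord1 adjE. Qed.

Lemma ket_tensE k l i j :
  (ket R k *t ket R l) (mxtens_index (i, j)) 0 = ((i == k) && (j == l))%:R.
Proof.
have -> : 0 = mxtens_index (0 : 'I_1, 0 : 'I_1) :> 'I_(1 * 1) by apply: val_inj.
by rewrite tensmxE !mxE !andbT -natrM mulnb.
Qed.

Lemma projDE n a (u v : 'cV[C]_n) x y :
  proj (a *: (u + v)) x y = a * (u x 0 + v x 0) * (a * (u y 0 + v y 0))^*.
Proof. by rewrite projE !mxE. Qed.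

Lemma projBE n a (u v : 'cV[C]_n) x y :
  proj (a *: (u - v)) x y = a * (u x 0 - v x 0) * (a * (u y 0 - v y 0))^*.
Proof. by rewrite projE !mxE. Qed.

Lemma lin4E m n a1 a2 a3 a4 (A1 A2 A3 A4 : 'M[C]_(m, n)) x y :
  (a1 *: A1 + a2 *: A2 + a3 *: A3 + a4 *: A4) x y =
  a1 * A1 x y + a2 * A2 x y + a3 * A3 x y + a4 * A4 x y.
Proof. by rewrite !mxE. Qed.

(* Each projector is expanded by its own instance: rewriting would compare the
   Bell vectors with each other up to conversion, which does not terminate in
   reasonable time. *)
Lemma bell_diagE p x y (s := isqrt2 R)
    (e := fun k l x => (ket R k *t ket R l) x 0) (K := k0) (L := k1) :
  bell_diag p x y =
    real_complex R (p 0) * (s * (e K K x + e L L x) * (s * (e K K y + e L L y))^*)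
  + real_complex R (p 1) * (s * (e K L x + e L K x) * (s * (e K L y + e L K y))^*)
  + real_complex R (p 2) * (s * (e K L x - e L K x) * (s * (e K L y - e L K y))^*)
  + real_complex R (p 3) * (s * (e K K x - e L L x) * (s * (e K K y - e L L y))^*).
Proof.
apply: etrans (lin4E _ _ _ _ _ _ _ _ _ _) _.
congr (_ * _ + _ * _ + _ * _ + _ * _); [exact: projDE | exact: projDE | | ];
  exact: projBE.
Qed.

Lemma bell_diag_pauli p i j b c :
  4 * bell_diag p (mxtens_index (i, b)) (mxtens_index (j, c)) =
  \sum_mu (real_complex R (bell_corr p mu)) * sigma R mu i j * sigma R mu b c.
Proof.
rewrite [RHS]sum_ord4 ![in RHS]mxE /bell_corr /= ?complexiE.
rewrite bell_diagE !ket_tensE.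
rewrite !(rmorphM, rmorphD, rmorphN) /=.
rewrite !conjC_nat !isqrt2_conj.
(* The normalisations occur in pairs, so the square root disappears and the sixteen entries can be
   checked algebraically. *)
have hs x y : isqrt2 R * x * (isqrt2 R * y) = 2^-1 * (x * y).
  by rewrite mulrACA isqrt2_sqr.
rewrite !hs; have hi := mulCii.
case: i => [[|[|//]] ?]; case: b => [[|[|//]] ?]; case: j => [[|[|//]] ?];
  case: c => [[|[|//]] ?]; rewrite /=; by field: hi.
Qed.
End Pauli.

(** * Negativity of a Bell diagonal state measured in a fixed basis *)

Section BellDiagonal.
Local Set Implicit Arguments. Local Unset Strict Implicit.
Variable R : rcfType.
Local Notation C := R[i].

(* <a_k| sigma_mu |a_l> *)
Definition pauli_elt (U : 'M[C]_2) (mu : 'I_4) (k l : 'I_2) : C :=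
  \sum_i \sum_j (U i k)^* * sigma R mu i j * U j l.

Lemma meas_block_bell_diag U p k l :
  meas_block U (bell_diag p) k l =
  \sum_mu (4^-1 * real_complex R (bell_corr p mu) * pauli_elt U mu k l) *: sigma R mu.
Proof.
apply/matrixP => b c; rewrite mxE summxE.
have four_neq0 : 4 != 0 :> C by rewrite pnatr_eq0.
apply: (mulfI four_neq0); rewrite !mulr_sumr.
transitivity (\sum_i \sum_j \sum_mu (U i k)^* *
   ((bell_corr p mu)%:C%C * sigma R mu i j * sigma R mu b c) * U j l).
  apply: eq_bigr => i _; rewrite mulr_sumr; apply: eq_bigr => j _.
  by rewrite -mulr_suml -mulr_sumr -bell_diag_pauli; ring.
under eq_bigr => i _ do rewrite exchange_big.
rewrite exchange_big; apply: eq_bigr => mu _.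
rewrite [in RHS]mxE -[4^-1 * _ * _]mulrA -[4^-1 * _ * _]mulrA mulVKf //.
rewrite /pauli_elt !mulr_sumr !mulr_suml; apply: eq_bigr => i _.
by rewrite !mulr_sumr !mulr_suml; apply: eq_bigr => j _; ring.
Qed.

(* 8 times the squared trace norm of sum_i c_i v_i sigma_i / 4, for d_i = c_i^2 *)
Definition weight (d1 d2 d3 v1 v2 v3 : C) : C :=
  d1 * `|v1| ^+ 2 + d2 * `|v2| ^+ 2 + d3 * `|v3| ^+ 2
  + `|d1 * v1 ^+ 2 + d2 * v2 ^+ 2 + d3 * v3 ^+ 2|.

Section Unitary.
Variable U : 'M[C]_2.
Local Notation v := (pauli_elt U).

Lemma pauli_elt0 k l : v 0 k l = (U 0 k)^* * U 0 l + (U 1 k)^* * U 1 l.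
Proof. by rewrite /pauli_elt !sum_ord2 !mxE /=; ring. Qed.

Lemma pauli_elt1 k l : v 1 k l = (U 0 k)^* * U 1 l + (U 1 k)^* * U 0 l.
Proof. by rewrite /pauli_elt !sum_ord2 !mxE /=; ring. Qed.

Lemma pauli_elt2 k l : v 2 k l = 'i * ((U 1 k)^* * U 0 l - (U 0 k)^* * U 1 l).
Proof. by rewrite /pauli_elt !sum_ord2 !mxE /= ?complexiE; ring. Qed.

Lemma pauli_elt3 k l : v 3 k l = (U 0 k)^* * U 0 l - (U 1 k)^* * U 1 l.
Proof. by rewrite /pauli_elt !sum_ord2 !mxE /=; ring. Qed.

Definition pauli_eltE := (pauli_elt0, pauli_elt1, pauli_elt2, pauli_elt3).

Lemma pauli_elt_conj mu k l : (v mu k l)^* = v mu l k.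
Proof.
have herm i j : (sigma R mu i j)^* = sigma R mu j i.
  rewrite !mxE; case: mu => [[|[|[|[|//]]]] ?]; case: i => [[|[|//]] ?];
    by case: j => [[|[|//]] ?];
    rewrite /= ?complexiE ?rmorphN ?conjC0 ?conjC1 //= ?conjCi ?opprK ?conjC1.
rewrite /pauli_elt rmorph_sum exchange_big; apply: eq_bigr => i _ /=.
rewrite rmorph_sum; apply: eq_bigr => j _ /=.
by rewrite !rmorphM /= conjCK herm; ring.
Qed.

(** This identity and the next are matrix elements of the Fierz identity: the sum of sigma_i (x)
    sigma_i over i = 1, 2, 3 is twice the swap minus the identity. *)
Lemma pauli_fierz_sqr k l : v 1 k l ^+ 2 + v 2 k l ^+ 2 + v 3 k l ^+ 2 = v 0 k l ^+ 2.
Proof. have hi := mulCii R; rewrite !pauli_eltE; ring: hi. Qed.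

Lemma pauli_fierz_norm k l :
  `|v 1 k l| ^+ 2 + `|v 2 k l| ^+ 2 + `|v 3 k l| ^+ 2 =
  2 * (v 0 k k * v 0 l l) - v 0 k l * v 0 l k.
Proof.
have hi := mulCii R; rewrite !normCK !pauli_elt_conj !pauli_eltE; ring: hi.
Qed.

Hypothesis Uu : orthonormal_basis U.

Lemma pauli_elt0_unitary k l : v 0 k l = (k == l)%:R.
Proof.
rewrite pauli_elt0; have := congr1 (fun M : 'M_2 => M k l) Uu.
by rewrite !mxE sum_ord2 !adjE => ->.
Qed.

Lemma pauli_offdiag_sqr : v 1 0 1 ^+ 2 + v 2 0 1 ^+ 2 + v 3 0 1 ^+ 2 = 0.
Proof. by rewrite pauli_fierz_sqr pauli_elt0_unitary /= expr0n. Qed.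

Lemma pauli_offdiag_norm :
  `|v 1 0 1| ^+ 2 + `|v 2 0 1| ^+ 2 + `|v 3 0 1| ^+ 2 = 2.
Proof. by rewrite pauli_fierz_norm !pauli_elt0_unitary /= mulr0 subr0 !mulr1. Qed.

Variable p : 'I_4 -> R.
Hypotheses (p_ge0 : forall i, 0 <= p i) (p_sum : \sum_i p i = 1).

Local Notation c := (fun mu => real_complex R (bell_corr p mu)).

Lemma bell_corr0 : c 0 = 1.
Proof. by rewrite /bell_corr -sum_ord4 p_sum. Qed.

Lemma bell_corr_sqr_le1 mu : c mu ^+ 2 <= 1.
Proof.
(* In 1 - c^2 = (1 - c)(1 + c), both factors are nonnegative combinations of the probabilities. *)
rewrite -rmorphXn lecR -subr_ge0 -[X in X - _](expr1n _ 2) subr_sqr.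
move: (p_ge0 0) (p_ge0 1) (p_ge0 2) (p_ge0 3) p_sum; rewrite sum_ord4 => *.
by case: mu => [[|[|[|[|//]]]] ?]; rewrite /bell_corr /= mulr_ge0 //; lra.
Qed.

(** Since c_i^2 <= 1 and the squares of the real numbers v_i sum to 1, the determinant is
    nonnegative. Without its modulus, the terms in sigma_1, sigma_2, sigma_3 cancel and twice the
    identity coefficient 1/4 remains. *)
Lemma trace_norm_diag_block k :
  trace_norm (meas_block U (bell_diag p) k k) = 2^-1.
Proof.
rewrite meas_block_bell_diag trace_norm_pauli bell_corr0 pauli_elt0_unitary eqxx.
have vR mu : v mu k k \is Num.real by rewrite CrealE pauli_elt_conj.
have cR mu : c mu \is Num.real by rewrite CrealE; apply/eqP/conjc_real.
have r4 : 4^-1 \is @Num.real C by rewrite rpredV realn.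
rewrite !real_normK ?rpredM ?rpred1 //.
have := pauli_fierz_sqr k k; rewrite pauli_elt0_unitary eqxx expr1n => vv.
rewrite ger0_norm; last first.
  suff: c 1 ^+ 2 * v 1 k k ^+ 2 + c 2 ^+ 2 * v 2 k k ^+ 2 + c 3 ^+ 2 * v 3 k k ^+ 2 <= 1.
    rewrite -subr_ge0 => h; rewrite [leRHS](_ : _ = 4^-1 ^+ 2 *
      (1 - (c 1 ^+ 2 * v 1 k k ^+ 2 + c 2 ^+ 2 * v 2 k k ^+ 2 + c 3 ^+ 2 * v 3 k k ^+ 2))).
      by rewrite mulr_ge0 // exprn_ge0 // invr_ge0 ler0n.
    by rewrite /=; ring.
  rewrite -vv; apply: lerD; [apply: lerD |]; rewrite ler_piMl ?bell_corr_sqr_le1 //;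
    by rewrite -real_normK // exprn_ge0.
rewrite -[RHS]sqrCK ?invr_ge0 ?ler0n //; congr sqrtC.
by rewrite /=; field.
Qed.

Local Notation offdiag_weight :=
  (weight (c 1 ^+ 2) (c 2 ^+ 2) (c 3 ^+ 2) (v 1 0 1) (v 2 0 1) (v 3 0 1)).

Lemma trace_norm_offdiag_block01 :
  trace_norm (meas_block U (bell_diag p) 0 1) = sqrtC (offdiag_weight / 8).
Proof.
rewrite meas_block_bell_diag trace_norm_pauli pauli_elt0_unitary /= mulr0.
have cR mu : c mu \is Num.real by rewrite CrealE; apply/eqP/conjc_real.
have n4 : `|4^-1 : C| = 4^-1 by rewrite normfV normr_nat.
have nw mu : `|4^-1 * c mu * v mu 0 1| ^+ 2 = 16^-1 * (c mu ^+ 2 * `|v mu 0 1| ^+ 2).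
  by rewrite !normrM n4 !exprMn (real_normK (cR _)) /=; field.
have factor16 : (4^-1 * c 1 * v 1 0 1) ^+ 2 + (4^-1 * c 2 * v 2 0 1) ^+ 2
    + (4^-1 * c 3 * v 3 0 1) ^+ 2 =
  4^-1 * (4^-1 * (c 1 ^+ 2 * v 1 0 1 ^+ 2 + c 2 ^+ 2 * v 2 0 1 ^+ 2
                  + c 3 ^+ 2 * v 3 0 1 ^+ 2)) by rewrite /=; ring.
have combine (x y z t : C) : 2 * (16^-1 * x + 16^-1 * y + 16^-1 * z) +
    2 * (4^-1 * (4^-1 * t)) = (x + y + z + t) / 8 by field.
rewrite factor16 !nw normr0 expr0n /= add0r sub0r normrN.
by rewrite (normrM 4^-1) (normrM 4^-1) n4 combine.
Qed.

(** The Pauli coefficients are conjugate to those of the other off-diagonal block, which leaves all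
    moduli unchanged. *)
Lemma trace_norm_offdiag_block10 :
  trace_norm (meas_block U (bell_diag p) 1 0) = sqrtC (offdiag_weight / 8).
Proof.
rewrite -trace_norm_offdiag_block01 !meas_block_bell_diag !trace_norm_pauli.
have cC mu : (c mu)^* = c mu by apply: conjc_real.
have wC mu : 4^-1 * c mu * v mu 1 0 = (4^-1 * c mu * v mu 0 1)^*.
  by rewrite !rmorphM /= cC pauli_elt_conj fmorphV /= conjC_nat.
have norm_form (x y z t : C) : `|x^* ^+ 2 - (y^* ^+ 2 + z^* ^+ 2 + t^* ^+ 2)| =
    `|x ^+ 2 - (y ^+ 2 + z ^+ 2 + t ^+ 2)|.
  by rewrite -[RHS]norm_conjC rmorphB !rmorphD !rmorphXn.
by rewrite !wC !norm_conjC norm_form.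
Qed.

Lemma negativity_bell_diag :
  negativity (post_meas_state U (bell_diag p)) = sqrtC (offdiag_weight / 8).
Proof.
have combine (x y z t u : C) :
    x = 2^-1 -> y = u -> z = u -> t = 2^-1 -> (x + y + (z + t) - 1) / 2 = u.
  by move=> -> -> -> ->; field.
rewrite /negativity trace_norm_ptrans_post_meas //.
under eq_bigr do rewrite sum_ord2.
rewrite sum_ord2.
apply: combine.
- exact: trace_norm_diag_block.
- exact: trace_norm_offdiag_block01.
- exact: trace_norm_offdiag_block10.
- exact: trace_norm_diag_block.
Qed.

End Unitary.
End BellDiagonal.

(** * Minimisation over the bases and the median correlation *)

Section Optimum.
Local Set Implicit Arguments. Local Unset Strict Implicit.
Variable R : rcfType.
Local Notation C := R[i].

Lemma pauli_orthogonal mu nu :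
  \sum_i \sum_j sigma R mu i j * sigma R nu j i = 2 * (mu == nu)%:R.
Proof.
have hi := mulCii R.
case: mu => [[|[|[|[|//]]]] ?]; case: nu => [[|[|[|[|//]]]] ?];
  by rewrite !big_ord_recl !big_ord0 !mxE /= ?complexiE; ring: hi.
Qed.

(** Each term of the Pauli expansion has a trace that factors over the two qubits into the square of
    Tr(sigma_mu sigma_nu); orthogonality leaves 2^2, against the factor 4. *)
Lemma corr_bell_diag p mu :
  corr (bell_diag p) mu mu = real_complex R (bell_corr p mu).
Proof.
have four_neq0 : 4 != 0 :> C by rewrite pnatr_eq0.
apply: (mulfI four_neq0); rewrite /corr /mxtrace mulr_sumr sum_mxtens_index.
transitivity (\sum_i \sum_b \sum_j \sum_c \sum_nu real_complex R (bell_corr p nu) *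
  (sigma R mu i j * sigma R nu j i) * (sigma R mu b c * sigma R nu c b)).
  apply: eq_bigr => i _; apply: eq_bigr => b _.
  rewrite mxE mulr_sumr sum_mxtens_index.
  apply: eq_bigr => j _; apply: eq_bigr => c _.
  rewrite tensmxE mulrCA bell_diag_pauli mulr_sumr.
  by apply: eq_bigr => nu _; ring.
transitivity (\sum_nu real_complex R (bell_corr p nu) *
   (\sum_i \sum_j sigma R mu i j * sigma R nu j i) ^+ 2).
  under eq_bigr => i _ do under eq_bigr => b _ do
    (under eq_bigr => j _ do rewrite exchange_big; rewrite exchange_big).
  under eq_bigr => i _ do rewrite exchange_big.
  rewrite exchange_big; apply: eq_bigr => nu _.
  rewrite expr2 mulrA [X in X * _]mulr_sumr [RHS]mulr_suml; apply: eq_bigr => i _.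
  rewrite [RHS]mulr_sumr; apply: eq_bigr => b _.
  rewrite [X in X * _]mulr_sumr [RHS]mulr_suml; apply: eq_bigr => j _.
  by rewrite mulr_sumr.
under eq_bigr do rewrite pauli_orthogonal.
rewrite (bigD1 mu) //= big1 => [|nu numu]; first by rewrite eqxx /=; ring.
by rewrite eq_sym (negPf numu) mulr0 expr0n mulr0.
Qed.

(** The two adjacent swaps generate all permutations, so every ordering of the correlations reduces
    to the increasing one. *)
Lemma weight_swap12 (d1 d2 d3 v1 v2 v3 : C) :
  weight d1 d2 d3 v1 v2 v3 = weight d2 d1 d3 v2 v1 v3.
Proof.
rewrite /weight [d1 * v1 ^+ 2 + _]addrC.
by rewrite [d1 * `|v1| ^+ 2 + _]addrC.
Qed.

Lemma weight_swap23 (d1 d2 d3 v1 v2 v3 : C) :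
  weight d1 d2 d3 v1 v2 v3 = weight d1 d3 d2 v1 v3 v2.
Proof.
rewrite /weight [_ + d3 * v3 ^+ 2]addrAC.
by rewrite [_ + d3 * `|v3| ^+ 2]addrAC.
Qed.

Lemma median_lower_bound (d1 d2 d3 v1 v2 v3 : C) :
    d1 <= d2 -> d2 <= d3 -> v1 ^+ 2 + v2 ^+ 2 + v3 ^+ 2 = 0 ->
    `|v1| ^+ 2 + `|v2| ^+ 2 + `|v3| ^+ 2 = 2 ->
  2 * d2 <= weight d1 d2 d3 v1 v2 v3.
Proof.
rewrite /weight => d12 d23 vv nvv; pose a := (d3 - d2) * v3 ^+ 2; pose b := (d2 - d1) * v1 ^+ 2.
(* Subtracting [d2] times the vanishing sum of squares removes the middle term. *)
have -> : d1 * v1 ^+ 2 + d2 * v2 ^+ 2 + d3 * v3 ^+ 2 = a - b.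
  by rewrite /a /b -[LHS]subr0 -[X in _ - X](mulr0 d2) -vv; ring.
have na : `|a| = (d3 - d2) * `|v3| ^+ 2 by rewrite normrM normrX ger0_norm ?subr_ge0.
have nb : `|b| = (d2 - d1) * `|v1| ^+ 2 by rewrite normrM normrX ger0_norm ?subr_ge0.
(* With 2 written as the sum of the |v_i|^2, the claim becomes the reverse triangle inequality. *)
rewrite -nvv -subr_ge0 [leRHS](_ : _ = `|a - b| - (`|b| - `|a|)).
  by rewrite subr_ge0 distrC lerB_dist.
by rewrite na nb; ring.
Qed.

(** Here v1^2 = - v2^2, so both have modulus 1 and the weight is d1 + d2 + (d2 - d1). *)
Lemma median_attained (d1 d2 d3 v1 v2 v3 : C) :
    d1 <= d2 -> v3 = 0 -> v1 ^+ 2 + v2 ^+ 2 + v3 ^+ 2 = 0 ->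
    `|v1| ^+ 2 + `|v2| ^+ 2 + `|v3| ^+ 2 = 2 ->
  weight d1 d2 d3 v1 v2 v3 = 2 * d2.
Proof.
rewrite /weight => d12 ->; rewrite normr0 expr0n /= !mulr0 !addr0 => /eqP.
rewrite addr_eq0 => /eqP v12.
have nv12 : `|v1| ^+ 2 = `|v2| ^+ 2 by rewrite -!normrX v12 normrN.
rewrite nv12 -mulr2n => nv.
have nv2 : `|v2| ^+ 2 = 1 by apply: (@mulfI C 2); rewrite ?pnatr_eq0 // mulr_natl nv mulr1.
have -> : d1 * v1 ^+ 2 + d2 * v2 ^+ 2 = (d2 - d1) * v2 ^+ 2 by rewrite v12; ring.
by rewrite normrM normrX ger0_norm ?subr_ge0 // nv2; ring.
Qed.

(** A case analysis on this yields the median together with the ordering, which the digits of the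
    constructor spell out from smallest to largest. *)
Variant median_spec (x y z : C) : C -> Type :=
  | Median123 of x <= y & y <= z : median_spec x y z y
  | Median132 of x <= z & z <= y : median_spec x y z z
  | Median213 of y <= x & x <= z : median_spec x y z x
  | Median231 of y <= z & z <= x : median_spec x y z z
  | Median312 of z <= x & x <= y : median_spec x y z x
  | Median321 of z <= y & y <= x : median_spec x y z y.

(** The order on [C] is partial; realness makes the three entries comparable. *)
Lemma sort3_medianP (x y z : C) :
    x \is Num.real -> y \is Num.real -> z \is Num.real ->
  median_spec x y z (nth 0 (sort <=%R [:: x; y; z]) 1).
Proof.
move=> xR yR zR; rewrite /sort /=.
case: (real_leP xR yR) => xy; case: (real_leP yR zR) => yz;
  case: (real_leP xR zR) => xz;
  rewrite /= ?xz ?yz ?(lt_geF xz) ?(lt_geF yz) /=;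
  by constructor; solve [assumption | apply: ltW; assumption].
Qed.

Lemma sqr_le (s t : C) : 0 <= s -> s <= t -> s ^+ 2 <= t ^+ 2.
Proof. by move=> s0 st; rewrite lerXn2r ?nnegrE // (le_trans s0). Qed.

Lemma weight_ge_median (x y z m v1 v2 v3 : C) :
    0 <= x -> 0 <= y -> 0 <= z -> median_spec x y z m ->
    v1 ^+ 2 + v2 ^+ 2 + v3 ^+ 2 = 0 ->
    `|v1| ^+ 2 + `|v2| ^+ 2 + `|v3| ^+ 2 = 2 ->
  2 * m ^+ 2 <= weight (x ^+ 2) (y ^+ 2) (z ^+ 2) v1 v2 v3.
Proof.
move=> x0 y0 z0 [] h1 h2 vv nv.
- by apply: median_lower_bound => //; apply: sqr_le.
- rewrite weight_swap23.
  apply: median_lower_bound; rewrite ?sqr_le //; first by rewrite -[RHS]vv; ring.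
  by rewrite -[RHS]nv; ring.
- rewrite weight_swap12.
  apply: median_lower_bound; rewrite ?sqr_le //; first by rewrite -[RHS]vv; ring.
  by rewrite -[RHS]nv; ring.
- rewrite weight_swap12 weight_swap23.
  apply: median_lower_bound; rewrite ?sqr_le //; first by rewrite -[RHS]vv; ring.
  by rewrite -[RHS]nv; ring.
- rewrite weight_swap23 weight_swap12.
  apply: median_lower_bound; rewrite ?sqr_le //; first by rewrite -[RHS]vv; ring.
  by rewrite -[RHS]nv; ring.
- rewrite weight_swap12 weight_swap23 weight_swap12.
  apply: median_lower_bound; rewrite ?sqr_le //; first by rewrite -[RHS]vv; ring.
  by rewrite -[RHS]nv; ring.
Qed.

(** Distinct vectors of an eigenbasis of sigma_mu have no sigma_mu matrix element between them. The
    columns of the witnesses are (|0> ± |1>)/√2, (|0> ± i|1>)/√2 and |0>, |1>. *)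
Lemma exists_pauli_eigenbasis (mu : 'I_4) : mu != 0 ->
  exists2 U : 'M[C]_2, orthonormal_basis U & pauli_elt U mu 0 1 = 0.
Proof.
pose s := isqrt2 R.
have conjs : s^* = s := isqrt2_conj R.
have hs : s * s = 2^-1 := isqrt2_sqr R.
have hi := mulCii R.
pose mk (a b c d : C) : 'M[C]_2 := \matrix_(i, j)
  (if i == 0 then if j == 0 then a else b else if j == 0 then c else d).
have mkU a b c d : a^* * a + c^* * c = 1 -> b^* * b + d^* * d = 1 ->
    a^* * b + c^* * d = 0 -> b^* * a + d^* * c = 0 -> orthonormal_basis (mk a b c d).
  move=> h1 h2 h3 h4; apply/matrixP => i j; rewrite mxE sum_ord2 !adjE !mxE.
  case: i => [[|[|//]] ?]; case: j => [[|[|//]] ?];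
  by rewrite /= (h1, h2, h3, h4).
case: mu => [[|[|[|[|//]]]] mu4] // _.
- exists (mk s s s (- s)).
    by apply: mkU; rewrite ?rmorphN /= conjs ?mulNr ?mulrN ?opprK hs; field.
  have -> : Ordinal mu4 = 1 by apply: val_inj.
  by rewrite pauli_elt1 !mxE /= conjs; ring.
- exists (mk s s ('i * s) (- 'i * s)).
    apply: mkU; rewrite ?rmorphM ?rmorphN /= conjs ?conjCi.
      by transitivity (2 * (s * s)); [ring: hi | rewrite hs; field].
    + by transitivity (2 * (s * s)); [ring: hi | rewrite hs; field].
    + by ring: hi.
    + by ring: hi.
  have -> : Ordinal mu4 = 2 by apply: val_inj.
  by rewrite pauli_elt2 !mxE /= ?rmorphM ?rmorphN /= conjs conjCi; ring: hi.
- exists (mk 1 0 0 1).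
    by apply: mkU; rewrite ?conjC0 ?conjC1; ring.
  have -> : Ordinal mu4 = 3 by apply: val_inj.
  by rewrite pauli_elt3 !mxE /= conjC0 conjC1; ring.
Qed.

(** The index [mu] is that of the largest of the three numbers. It is fixed before [v], because the
    basis that provides [v] is built from it. *)
Lemma weight_eq_median (x y z m : C) :
    0 <= x -> 0 <= y -> 0 <= z -> median_spec x y z m ->
  exists2 mu : 'I_4, mu != 0 & forall v : 'I_4 -> C, v mu = 0 ->
    v 1 ^+ 2 + v 2 ^+ 2 + v 3 ^+ 2 = 0 ->
    `|v 1| ^+ 2 + `|v 2| ^+ 2 + `|v 3| ^+ 2 = 2 ->
    weight (x ^+ 2) (y ^+ 2) (z ^+ 2) (v 1) (v 2) (v 3) = 2 * m ^+ 2.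
Proof.
move=> x0 y0 z0 [] h1 h2.
- by exists 3 => // v v0 vv nv; apply: median_attained; rewrite ?sqr_le.
- exists 2 => // v v0 vv nv; rewrite weight_swap23.
  by apply: median_attained; rewrite ?sqr_le // addrAC.
- exists 3 => // v v0 vv nv; rewrite weight_swap12.
  apply: median_attained; rewrite ?sqr_le //; first by rewrite -[RHS]vv; ring.
  by rewrite -[RHS]nv; ring.
- exists 1 => // v v0 vv nv; rewrite weight_swap12 weight_swap23.
  apply: median_attained; rewrite ?sqr_le //; first by rewrite -[RHS]vv; ring.
  by rewrite -[RHS]nv; ring.
- exists 2 => // v v0 vv nv; rewrite weight_swap23 weight_swap12.
  apply: median_attained; rewrite ?sqr_le //; first by rewrite -[RHS]vv; ring.
  by rewrite -[RHS]nv; ring.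
- exists 1 => // v v0 vv nv; rewrite weight_swap12 weight_swap23 weight_swap12.
  apply: median_attained; rewrite ?sqr_le //; first by rewrite -[RHS]vv; ring.
  by rewrite -[RHS]nv; ring.
Qed.

Lemma median_ge0 (x y z m : C) :
  0 <= x -> 0 <= y -> 0 <= z -> median_spec x y z m -> 0 <= m.
Proof. by move=> x0 y0 z0 []. Qed.

Lemma half_sqrtC (m : C) : 0 <= m -> m / 2 = sqrtC (2 * m ^+ 2 / 8).
Proof.
move=> m0; rewrite -[LHS]sqrCK ?divr_ge0 ?ler0n //; congr sqrtC.
by field.
Qed.

Lemma half_le_sqrtC (m w : C) : 0 <= m -> 2 * m ^+ 2 <= w -> m / 2 <= sqrtC (w / 8).
Proof.
move=> m0 mw; have m2 : 0 <= 2 * m ^+ 2 by rewrite mulr_ge0 ?exprn_ge0 ?ler0n.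
rewrite half_sqrtC // ler_sqrtC ?nnegrE ?divr_ge0 ?ler0n ?(le_trans m2 mw) //.
by rewrite ler_pM2r // invr_gt0 ltr0n.
Qed.

End Optimum.

Theorem theorem11 (R : rcfType) (p : 'I_4 -> R)
  (p_ge0 : forall i, 0 <= p i) (p_sum : \sum_(i < 4) p i = 1) :
  is_QNA (bell_diag p) (lambda2 (bell_diag p) / 2).
Proof.
pose c mu := corr (bell_diag p) mu mu.
(* The weight involves only squared correlations, so they can be replaced by the moduli that
   [lambda2] sorts. *)
have cE mu : real_complex R (bell_corr p mu) ^+ 2 = `|c mu| ^+ 2.
  rewrite /c corr_bell_diag real_normK //.
  by rewrite CrealE; apply/eqP/conjc_real.
have medP : median_spec `|c 1| `|c 2| `|c 3| (lambda2 (bell_diag p)).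
  by apply: sort3_medianP; apply: normr_real.
move: (lambda2 _) medP => m medP.
have m_ge0 : 0 <= m := median_ge0 (normr_ge0 _) (normr_ge0 _) (normr_ge0 _) medP.
split=> [U Uu|].
  rewrite (negativity_bell_diag Uu p_ge0 p_sum) !cE.
  apply: half_le_sqrtC => //.
  apply: weight_ge_median medP _ _; rewrite ?normr_ge0 //.
    exact: pauli_offdiag_sqr.
  exact: pauli_offdiag_norm.
have [mu mu0 wE] := weight_eq_median (normr_ge0 _) (normr_ge0 _) (normr_ge0 _) medP.
(* The optimal measurement is along the axis of largest absolute correlation. *)
have [U Uu v0] := exists_pauli_eigenbasis R mu0.
exists U; split=> //.
rewrite (negativity_bell_diag Uu p_ge0 p_sum) half_sqrtC // !cE.
congr (sqrtC (_ / _)); apply: (wE (fun nu => pauli_elt U nu 0 1)) => //.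
  exact: pauli_offdiag_sqr.
exact: pauli_offdiag_norm.
Qed.
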